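(* There exists an absolute constant $B>0$ such that the following holds. Let $M$ be a positive integer, let $T$ be a tournament on $M$ vertices, and let $q$ be an integer with $0\le q\le M$. Then there exists a set $X\subseteq V(T)$ such that $|X|=q$ and $$\left||N_T^+(v)\cap X|-\frac{q}{M}d_T^+(v)\right|\le B\sqrt{d_T^+(v)}\quad\text{for every } v\in V(T).$$
   Context: A tournament is a digraph obtained by orienting each edge of a finite complete graph in exactly one direction. For a tournament $T$ and a vertex $v$, $N_T^+(v)$ is the set of out-neighbours of $v$ in $T$ and $d_T^+(v)=|N_T^+(v)|$ is the out-degree of $v$. *)

(* Defs.v *)
From HB Require Import structures.
From mathcomp Require Import all_boot all_order all_algebra.
From mathcomp Require Import reals.

Set Implicit Arguments.
Unset Strict Implicit.
Unset Printing Implicit Defensive.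

(* [arc u v] reads "the edge uv is oriented from u to v". *)
Definition tournament (V : finType) (arc : rel V) : Prop :=
  irreflexive arc /\ forall u v : V, u != v -> arc u v (+) arc v u.

Definition out_nbhd (V : finType) (arc : rel V) (v : V) : {set V} :=
  [set w | arc v w].

Definition out_degree (V : finType) (arc : rel V) (v : V) : nat :=
  #|out_nbhd arc v|.

(* Main.v *)
Require Import Defs.
From HB Require Import structures.
From mathcomp Require Import boolp classical_sets topology normedtype derive.
From mathcomp Require Import realfun.
From mathcomp Require Import all_boot all_order all_algebra.
From mathcomp Require Import reals.
From mathcomp Require Import ring lra zify.

Set Implicit Arguments.
Unset Strict Implicit.
Unset Printing Implicit Defensive.

Import Order.TTheory GRing.Theory Num.Theory.
Import numFieldTopology.Exports numFieldNormedType.Exports.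
Local Open Scope ring_scope.

(** Start from the constant vector x0 = q/M on the vertices and move it, in
    phases, to a 0-1 vector with the same coordinate sum q. The set X is the
    support of the final vector, so the quantity to control is, for each vertex
    v, the total change of the sum of x over the out-neighbourhood of v.

    The tournament enters only through counting: n vertices of out-degree less
    than k span n(n-1)/2 arcs, which is at most n(k-1), so at most 2k vertices
    have out-degree below k ([card_small_out_degree]). Hence there are few short constraints, and this
    is what allows an error of the order of the square root of the degree,
    without a logarithm ([levelled_rounding]).

    A phase ([partial_rounding]) lowers the number of fractional coordinates
    from 16N to N, where N is a power of 16. It minimises the energy
      E(x) = sum_i c_i s_i(x)^4 - sum_v x_v^2,
    where s_i(x) is the change of the i-th constraint, over the polytope of
    those x in the cube that satisfy |s_i(x)| <= b_i and agree with the previous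
    vector wherever that one is integral. Minimality gives two facts
    ([energy_minimiser]).
    - Comparison with the starting point bounds sum_i c_i s_i^4 by 16N, so few
      of the bounds |s_i| <= b_i with b_i > 0 are tight.
    - Let W be the space of directions that are supported on the fractional
      coordinates and orthogonal to all tight constraints. The second derivative
      of E is nonnegative along W. Summed over an orthonormal basis of W, this
      bounds dim W by sum_i 6 c_i s_i^2 |a_i|^2 ([trace_bound_on]), where |a_i|
      is the norm on the fractional coordinates; this is small
      by the bound on the fourth powers.
    Since the number of fractional coordinates is at most dim W plus the number
    of tight constraints, it is at most N. The phase with N = 1 leaves at most one
    fractional coordinate, hence none because the coordinate sum is an integer.

    Constraints far shorter than N get b_i = 0: they are preserved exactly, and
    there are few of them. A constraint of length about N 16^(j-2) gets
    b_i = 128 sqrt(N) 3^j. The base 3 lies between 2 and 4: the sum over the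
    constraints of 1/b_i^4, in which about 16^j terms are of the order of
    81^(-j), converges because 16 < 81; the sum of b_i over the phases that
    affect a constraint of length d is a geometric series of ratio 3/4 because
    sqrt(16) = 4, so it is of the order of sqrt(d). *)

(** * Trace of a quadratic form on an orthogonal complement *)

Lemma col_sqnorm_eq0 (R : realFieldType) n (u : 'cV[R]_n) :
  (u^T *m u) 0 0 = 0 -> u = 0.
Proof.
rewrite mxE => /eqP; rewrite psumr_eq0 => [/allP u0|i _]; last first.
  by rewrite mxE -expr2 sqr_ge0.
apply/colP => i; rewrite [RHS]mxE.
by have /implyP/(_ isT) := u0 i (mem_index_enum i); rewrite mxE mulf_eq0 orbb => /eqP.
Qed.

(** The projector onto the orthogonal complement of [s], built one vector at a
    time: if [u] is the part of the new vector that survives the current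
    projector, subtracting the projector onto the line of [u] costs one unit of
    trace. *)
Lemma orthogonal_projector (R : realFieldType) n (s : seq 'cV[R]_n) :
  exists P : 'M[R]_n, [/\ P^T = P, P *m P = P,
    forall a, a \in s -> P *m a = 0 & n%:R - (size s)%:R <= \tr P].
Proof.
elim: s => [|a s [P [PT PP Ps trP]]].
  by exists 1%:M; split; rewrite ?trmx1 ?mulmx1 ?mxtrace1 ?subr0.
have trS : n%:R - (size (a :: s))%:R <= \tr P - 1 by rewrite /= -natr1; lra.
pose u := P *m a; have Pu : P *m u = u by rewrite mulmxA PP.
have uP : u^T *m P = u^T by rewrite -[in LHS]PT -trmx_mul Pu.
have [u0|uN0] := eqVneq u 0.
  exists P; split=> // [b|]; last by apply: le_trans trS _; lra.
  by rewrite inE => /predU1P[->|/Ps].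
pose d := (u^T *m u) 0 0.
have dN0 : d != 0 by apply: contraNneq uN0 => /col_sqnorm_eq0 ->.
have uu : u^T *m u = d%:M by rewrite [LHS]mx11_scalar.
have ua : u^T *m a = d%:M by rewrite -uP -mulmxA.
exists (P - d^-1 *: (u *m u^T)); split.
- by rewrite linearB linearZ /= trmx_mul trmxK PT.
- have PQ : P *m (u *m u^T) = u *m u^T by rewrite mulmxA Pu.
  have QP : u *m u^T *m P = u *m u^T by rewrite -mulmxA uP.
  have QQ : u *m u^T *m (u *m u^T) = d *: (u *m u^T).
    by rewrite -mulmxA [u^T *m (u *m _)]mulmxA uu mul_scalar_mx -scalemxAr.
  rewrite mulmxBl !mulmxBr PP -!scalemxAr -!scalemxAl PQ QP QQ.
  by rewrite (scalerA d^-1 d) mulVf // scale1r subrr subr0.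
- move=> b; rewrite inE => /predU1P[->|bs].
  + rewrite mulmxBl -/u -scalemxAl -mulmxA ua mul_mx_scalar.
    by rewrite scalerA mulVf // scale1r subrr.
  + rewrite mulmxBl Ps // -scalemxAl -mulmxA -uP -(mulmxA _ P) Ps //.
    by rewrite !mulmx0 scaler0 subrr.
- by rewrite linearB linearZ /= mxtrace_mulC uu mxtrace_scalar mulr1n mulVf //.
Qed.

(** Take the trace of both quadratic forms over the orthogonal complement of [s]:
    the left one gives the dimension, which is at least [n - size s], and the
    right one cannot exceed its trace over the whole space. The trace is computed
    by testing on the projections of the standard basis vectors. *)
Lemma trace_bound (R : realFieldType) n (I : finType) (s : seq 'cV[R]_n)
    (w : I -> R) (b : I -> 'cV[R]_n) :
  (forall i, 0 <= w i) ->
  (forall y : 'cV[R]_n, (forall a, a \in s -> a^T *m y = 0) ->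
     (y^T *m y) 0 0 <= \sum_i w i * ((b i)^T *m y) 0 0 ^+ 2) ->
  n%:R <= (size s)%:R + \sum_i w i * ((b i)^T *m b i) 0 0.
Proof.
move=> w0 H; have [P [PT PP Ps trP]] := orthogonal_projector s.
rewrite -lerBlDl; apply: le_trans trP _.
have -> : \tr P = \sum_j ((P *m delta_mx j (0 : 'I_1))^T *m (P *m delta_mx j (0 : 'I_1))) 0 0.
  apply: eq_bigr => j _; rewrite trmx_mul PT -mulmxA (mulmxA P P) PP.
  by rewrite -colE trmx_delta -rowE !mxE.
apply: (@le_trans _ _ (\sum_j \sum_i
    w i * ((b i)^T *m (P *m delta_mx j (0 : 'I_1))) 0 0 ^+ 2)).
  apply: ler_sum => j _; apply: H => a /Ps Pa.
  by rewrite mulmxA -{1}PT -trmx_mul Pa trmx0 mul0mx.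
rewrite exchange_big; apply: ler_sum => i _; rewrite -mulr_sumr.
apply: ler_wpM2l => //.
pose c := P *m b i.
have -> : \sum_j ((b i)^T *m (P *m delta_mx j (0 : 'I_1))) 0 0 ^+ 2 = (c^T *m c) 0 0.
  rewrite mxE; apply: eq_bigr => j _; rewrite mulmxA -{1}PT -trmx_mul -/c.
  by rewrite -colE !mxE expr2.
have e : (b i)^T *m b i = c^T *m c + (b i - c)^T *m (b i - c).
  have cc : c^T *m c = (b i)^T *m c by rewrite trmx_mul PT -mulmxA [P *m c]mulmxA PP.
  have cb : c^T *m b i = (b i)^T *m c by rewrite trmx_mul PT -mulmxA.
  rewrite [(b i - c)^T]linearB /= mulmxBl !mulmxBr cc cb.
  by rewrite subrr subr0 addrC subrK.
rewrite e [leRHS]mxE lerDl mxE sumr_ge0 // => j _.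
by rewrite mxE -expr2 sqr_ge0.
Qed.

(** The same bound in the space of functions supported on [A]: the coordinates
    outside [A] are killed by adding their unit vectors to the constraints, and
    the forms are cut down to [A] so that only the weight of [a i] on [A] is paid. *)
Lemma trace_bound_on (R : realFieldType) (V I : finType) (A : {set V})
    (T : {set I}) (a : I -> V -> R) (w : I -> R) :
  (forall i, 0 <= w i) ->
  (forall y : V -> R, (forall v, v \notin A -> y v = 0) ->
     (forall i, i \in T -> \sum_v a i v * y v = 0) ->
     \sum_v y v ^+ 2 <= \sum_i w i * (\sum_v a i v * y v) ^+ 2) ->
  #|A|%:R <= #|T|%:R + \sum_i w i * \sum_(v in A) a i v ^+ 2.
Proof.
move=> w0 H.
pose vec (f : V -> R) : 'cV[R]_#|V| := \col_i f (enum_val i).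
have vecE f g : ((vec f)^T *m vec g) 0 0 = \sum_v f v * g v.
  rewrite mxE [RHS](reindex _ (onW_bij _ (enum_val_bij V))).
  by apply: eq_bigr => i _; rewrite !mxE.
pose e v : V -> R := fun u => (u == v)%:R.
pose s := [seq vec (e v) | v in ~: A] ++ [seq vec (a i) | i in T].
pose b i v := if v \in A then a i v else 0.
have := @trace_bound R _ _ s w (fun i => vec (b i)) w0.
have -> : (size s)%:R = #|V|%:R - #|A|%:R + #|T|%:R :> R.
  by rewrite size_cat !size_image natrD -(cardsC A) natrD; congr (_ + _); ring.
have -> : \sum_i w i * ((vec (b i))^T *m vec (b i)) 0 0
    = \sum_i w i * \sum_(v in A) a i v ^+ 2.
  apply: eq_bigr => i _; rewrite vecE [in RHS]big_mkcond; congr (_ * _).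
  by apply: eq_bigr => v _; rewrite /b; case: ifP; rewrite ?mulr0 ?expr2.
suff h : forall y : 'cV[R]_#|V|, (forall a, a \in s -> a^T *m y = 0) ->
     (y^T *m y) 0 0 <= \sum_i w i * ((vec (b i))^T *m y) 0 0 ^+ 2.
  by move=> /(_ h); lra.
move=> y ys; pose z v := y (enum_rank v) 0.
have yE : y = vec z by apply/colP => i; rewrite mxE /z enum_valK.
have orth f : vec f \in s -> \sum_v f v * z v = 0.
  by move=> /ys; rewrite -vecE -yE => ->; rewrite mxE.
have zA v : v \notin A -> z v = 0.
  move=> vA; rewrite -[RHS](orth (e v)).
    rewrite (bigD1 v) //= /e eqxx mul1r big1 ?addr0 // => u /negbTE ->.
    by rewrite mul0r.
  by rewrite mem_cat; apply/orP; left; apply: map_f; rewrite mem_enum inE.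
have -> : (y^T *m y) 0 0 = \sum_v z v ^+ 2.
  by rewrite yE vecE; apply: eq_bigr => v _; rewrite expr2.
apply: le_trans (H z zA _) _.
  move=> i iT; apply: orth; rewrite mem_cat; apply/orP; right.
  by apply: map_f; rewrite mem_enum.
apply: ler_sum => i _; rewrite {1}yE vecE.
rewrite (eq_bigr (fun v => b i v * z v)) // => v _.
by rewrite /b; case: ifPn => // /zA ->; rewrite !mulr0.
Qed.

(** * Minimisation over a box with bounded continuous constraints *)

Lemma coordinate_continuous (R : realType) (V : finType) (v : V) :
  continuous (fun x : prod_topology (fun _ : V => R) => x v).
Proof. exact: (@proj_continuous V (fun=> R) v). Qed.

Lemma continuous_fsum (R : realType) (T : topologicalType) (I : finType)
    (f : I -> T -> R) :
  (forall i, continuous (f i)) -> continuous (fun x => \sum_i f i x).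
Proof.
by move=> cf x; apply: cvg_big => [|i _]; [exact: add_continuous|exact: cf].
Qed.

Lemma box_minimiser (R : realType) (V I : finType) (lo hi : V -> R)
    (g : I -> prod_topology (fun _ : V => R) -> R) (b : I -> R)
    (F : prod_topology (fun _ : V => R) -> R) (x0 : V -> R) :
  (forall i, continuous (g i)) -> continuous F ->
  (forall v, lo v <= x0 v <= hi v) -> (forall i, `|g i x0| <= b i) ->
  exists x : V -> R, [/\ forall v, lo v <= x v <= hi v,
    forall i, `|g i x| <= b i &
    forall z : V -> R, (forall v, lo v <= z v <= hi v) ->
      (forall i, `|g i z| <= b i) -> F x <= F z].
Proof.
move=> cg cF x0box x0b.
pose K : set (prod_topology (fun _ : V => R)) :=
  ([set x | forall v, `[lo v, hi v]%classic (x v)] `&`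
   \bigcap_(i in [set: I]) (g i @^-1` `[- b i, b i]%classic))%classic.
have KP x : K x <-> (forall v, lo v <= x v <= hi v) /\ (forall i, `|g i x| <= b i).
  split=> -[h1 h2]; split.
  - by move=> v; have := h1 v; rewrite /= in_itv.
  - by move=> i; have := h2 i Logic.I; rewrite /= in_itv /= ler_norml.
  - by move=> v; rewrite /= in_itv /=; exact: h1.
  - by move=> i _; rewrite /= in_itv /= -ler_norml; exact: h2.
have Kc : compact K.
  apply: compact_closedI.
    apply: (@tychonoff V (fun=> R) (fun v => `[lo v, hi v]%classic)) => v.
    exact: segment_compact.
  apply: closed_bigI => i _; apply: preimage_closed.
    by move=> x _; exact: cg.
  exact: itv_closed.
have K0 : (K !=set0)%classic by exists x0; apply/KP.
have [x xK xmin] := compact_EVT_min K0 Kc (continuous_subspaceT cF).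
move: xK; rewrite in_setE => /KP [xbox xb]; exists x; split=> // z zbox zb.
by apply: xmin; rewrite in_setE; apply/KP.
Qed.

(** Finitely many strict inequalities survive a sufficiently small step. *)
Lemma small_step (R : realFieldType) (I : finType) (P : pred I) (s g : I -> R) :
  (forall i, P i -> 0 < s i) ->
  exists2 t0 : R, 0 < t0 & forall t, `|t| <= t0 ->
    forall i, P i -> `|t * g i| <= s i.
Proof.
move=> s0; pose q i := s i / (1 + `|g i|).
have g0 i : 0 < 1 + `|g i| by have := normr_ge0 (g i); lra.
exists (\big[Num.min/1]_(i | P i) q i).
  by elim/big_ind: _ => // [x y x0 y0|i Pi]; rewrite ?lt_min ?x0 ?divr_gt0 ?s0.
move=> t tq i Pi; rewrite normrM.
have : `|t| <= q i by apply: le_trans tq _; exact: bigmin_le_cond.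
by rewrite /q ler_pdivlMr // mulrDr mulr1; have := normr_ge0 t; lra.
Qed.

(** Lets the quartic term of a second difference be dropped. *)
Lemma le_of_small_square (R : realFieldType) (t0 p q r : R) :
  0 < t0 -> 0 <= r -> (forall t, 0 < t <= t0 -> p <= q + t ^+ 2 * r) -> p <= q.
Proof.
move=> t00 r0 H; rewrite leNgt; apply/negP => pq.
pose t := Num.min 1 (Num.min t0 ((p - q) / (2 * (1 + r)))).
have r1 : 0 < 2 * (1 + r) by lra.
have tpos : 0 < t by rewrite !lt_min ltr01 t00 divr_gt0 // subr_gt0.
have := H t; rewrite tpos /= {1}/t !ge_min lexx /= orbT => /(_ isT).
have t1 : t <= 1 by rewrite /t ge_min lexx.
have : t <= (p - q) / (2 * (1 + r)) by rewrite /t !ge_min lexx !orbT.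
rewrite ler_pdivlMr // => h; nra.
Qed.

(** * Minimisers of the rounding energy *)

Definition fractional (R : realType) (V : finType) (x : V -> R) : {set V} :=
  [set v | 0 < x v < 1].

Definition shift_along (R : realType) (V : finType) (f x0 x : V -> R) : R :=
  \sum_v f v * (x v - x0 v).

Lemma shift_along_line (R : realType) (V : finType) (f x0 x y : V -> R) t :
  shift_along f x0 (fun v => x v + t * y v) =
    shift_along f x0 x + t * \sum_v f v * y v.
Proof.
rewrite /shift_along mulr_sumr -big_split; apply: eq_bigr => v _ /=; ring.
Qed.

Lemma continuousX (R : realType) (T : topologicalType) (f : T -> R) n :
  continuous f -> continuous (fun x => f x ^+ n).
Proof.
move=> cf x; apply: (@continuous_comp T R R f (fun z => z ^+ n)); first exact: cf.
exact: exprn_continuous.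
Qed.

Lemma continuous_affine_comp (R : realType) (T : topologicalType) (f : T -> R)
    (p q : R) : continuous f -> continuous (fun x => p * (f x - q)).
Proof.
move=> cf x.
apply: (@cvgM R T (nbhs x) _ (fun=> p) (fun z => f z - q)); first exact: cvg_cst.
by apply: (@cvgB R R T (nbhs x) _ f (fun=> q)); [exact: cf|exact: cvg_cst].
Qed.

Lemma shift_along_continuous (R : realType) (V : finType) (f x0 : V -> R) :
  continuous (shift_along f x0 : prod_topology (fun _ : V => R) -> R).
Proof.
pose T : topologicalType := prod_topology (fun _ : V => R).
apply: (@continuous_fsum R T V (fun v (x : T) => f v * (x v - x0 v))) => v.
exact: (@continuous_affine_comp R T (fun x => x v) _ _ (@coordinate_continuous R V v)).
Qed.

Definition rounding_energy (R : realType) (V I : finType) (a : I -> V -> R)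
    (c : I -> R) (x0 x : V -> R) : R :=
  \sum_i c i * shift_along (a i) x0 x ^+ 4 - \sum_v x v ^+ 2.

Lemma rounding_energy_continuous (R : realType) (V I : finType)
    (a : I -> V -> R) (c : I -> R) (x0 : V -> R) :
  continuous (rounding_energy a c x0 : prod_topology (fun _ : V => R) -> R).
Proof.
pose T : topologicalType := prod_topology (fun _ : V => R).
pose e i (x : T) := c i * (shift_along (a i) x0 x ^+ 4 - 0).
have ce : continuous (fun x => \sum_i e i x).
  apply: continuous_fsum => i.
  apply: (@continuous_affine_comp R T (fun x : T => shift_along (a i) x0 x ^+ 4)).
  exact: (@continuousX R T _ 4 (@shift_along_continuous R V (a i) x0)).
have cq : continuous (fun x : T => \sum_v x v ^+ 2).
  apply: (@continuous_fsum R T V (fun v (x : T) => x v ^+ 2)) => v.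
  exact: (@continuousX R T _ 2 (@coordinate_continuous R V v)).
have -> : rounding_energy a c x0 = fun x => \sum_i e i x - \sum_v x v ^+ 2.
  by apply/funext => x; under [X in _ = X - _]eq_bigr do rewrite /e subr0.
move=> x; apply: (@cvgB R R T (nbhs x) _ (fun x => \sum_i e i x)
  (fun x => \sum_v x v ^+ 2)); [exact: ce|exact: cq].
Qed.

(** The even part of the energy along a line; the quartic term in [t] is the only
    obstruction to reading off the second-order condition exactly. *)
Lemma rounding_energy_second_difference (R : realType) (V I : finType)
    (a : I -> V -> R) (c : I -> R) (x0 x y : V -> R) (t : R) :
  let s i := shift_along (a i) x0 x in
  let g i := \sum_v a i v * y v in
  rounding_energy a c x0 (fun v => x v + t * y v)
    + rounding_energy a c x0 (fun v => x v + - t * y v)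
    - 2 * rounding_energy a c x0 x
  = 2 * t ^+ 2 * (\sum_i 6 * c i * s i ^+ 2 * g i ^+ 2
      + t ^+ 2 * \sum_i c i * g i ^+ 4 - \sum_v y v ^+ 2).
Proof.
move=> s g; rewrite /rounding_energy.
transitivity ((\sum_i c i * (s i + t * g i) ^+ 4
    + \sum_i c i * (s i + - t * g i) ^+ 4 - 2 * \sum_i c i * s i ^+ 4)
    - (\sum_v (x v + t * y v) ^+ 2 + \sum_v (x v + - t * y v) ^+ 2
       - 2 * \sum_v x v ^+ 2)).
  under eq_bigr do rewrite shift_along_line.
  under [X in _ + (X - _)]eq_bigr do rewrite shift_along_line.
  by rewrite /s /g; ring.
rewrite [RHS]mulrBr mulrDr; congr (_ - _).
  rewrite !mulr_sumr -!big_split -sumrB; apply: eq_bigr => i _ /=; ring.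
rewrite !mulr_sumr -!big_split -sumrB; apply: eq_bigr => v _ /=; ring.
Qed.

(** The conclusions are the two optimality conditions of a minimiser of the
    rounding energy under the constraints [`|s i| <= b i]: comparison with the
    starting point, where every shift vanishes, and nonnegativity of the second
    difference in the directions that keep the tight constraints fixed. Both [y]
    and [- y] are feasible there, so first-order terms cancel. *)
Lemma energy_minimiser (R : realType) (V I : finType) (a : I -> V -> R)
    (b c : I -> R) (x0 : V -> R) :
  (forall v, 0 <= x0 v <= 1) -> (forall i, 0 <= b i) -> (forall i, 0 <= c i) ->
  exists x : V -> R, let s i := shift_along (a i) x0 x in
  [/\ forall v, 0 <= x v <= 1, fractional x \subset fractional x0,
    forall i, `|s i| <= b i,
    \sum_i c i * s i ^+ 4 <= #|fractional x0|%:R &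
    #|fractional x|%:R <= #|[set i | `|s i| == b i]|%:R
      + \sum_i 6 * c i * s i ^+ 2 * \sum_(v in fractional x) a i v ^+ 2].
Proof.
move=> x01 b0 c0; pose A0 := fractional x0.
(* Coordinates that are already integral are frozen by a degenerate box. *)
pose lo v : R := if v \in A0 then 0 else x0 v.
pose hi v : R := if v \in A0 then 1 else x0 v.
have x0box v : lo v <= x0 v <= hi v.
  by rewrite /lo /hi; case: ifP => _ //; rewrite !lexx.
have s0 i : `|shift_along (a i) x0 x0| <= b i.
  by rewrite /shift_along big1 ?normr0 // => v _; rewrite subrr mulr0.
have [x [xbox xb xmin]] := box_minimiser
  (fun i => @shift_along_continuous R V (a i) x0)
  (@rounding_energy_continuous R V I a c x0) x0box s0.
have x1 v : 0 <= x v <= 1.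
  have := xbox v; rewrite /lo /hi; case: ifP => // _ /andP[h1 h2].
  by have /andP[] := x01 v; move=> *; apply/andP; split; lra.
have sub : fractional x \subset A0.
  apply/subsetP => v; apply: contraLR => vA0; have := xbox v.
  rewrite /lo /hi (negbTE vA0) => /andP[h1 h2].
  have e : x v = x0 v by lra.
  by move: vA0; rewrite !inE e.
exists x => s; split=> //.
  have := xmin x0 x0box s0; rewrite /rounding_energy -/s.
  rewrite [X in _ <= X - _]big1 ?sub0r => [h|i _]; last first.
    rewrite /shift_along big1 ?expr0n ?mulr0 // => v _; by rewrite subrr mulr0.
  have {h} : \sum_i c i * s i ^+ 4 <= \sum_v x v ^+ 2 - \sum_v x0 v ^+ 2.
    by rewrite -/s in h; lra.
  move=> /le_trans; apply; rewrite -sumrB -sum1_card natr_sum [leRHS]big_mkcond /=.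
  apply: ler_sum => v _; have := xbox v; rewrite /lo /hi.
  case: ifP => _ /andP[h1 h2]; last first.
    have -> : x v = x0 v by lra.
    by rewrite subrr.
  by have := sqr_ge0 (x0 v); nra.
apply: trace_bound_on => [i|y yA yT].
  by apply: mulr_ge0; [apply: mulr_ge0|exact: sqr_ge0].
pose g i := \sum_v a i v * y v.
have [t1 t10 ht1] := @small_step R V (mem (fractional x))
  (fun v => Num.min (x v) (1 - x v)) y
  (fun v => ltac:(by rewrite /= inE lt_min subr_gt0)).
have [t2 t20 ht2] := @small_step R I (fun i => `|s i| != b i)
  (fun i => b i - `|s i|) g
  (fun i => ltac:(by rewrite subr_gt0 lt_neqAle xb andbT)).
have feasible t : `|t| <= t1 -> `|t| <= t2 ->
    rounding_energy a c x0 x <= rounding_energy a c x0 (fun v => x v + t * y v).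
  move=> tt1 tt2; apply: xmin => [v|i].
    have [vA|/yA ->] := boolP (v \in fractional x); last by rewrite mulr0 addr0.
    have := ht1 t tt1 v vA; rewrite le_min !ler_norml /lo /hi.
    rewrite (subsetP sub _ vA) => /andP[/andP[h1 h2] /andP[h3 h4]].
    by apply/andP; split; lra.
  rewrite shift_along_line -/(s i) -/(g i).
  have [sb|sb] := eqVneq `|s i| (b i).
    have -> : g i = 0 by apply: yT; rewrite inE sb.
    by rewrite mulr0 addr0 sb.
  by have := ht2 t tt2 i sb; have := ler_normD (s i) (t * g i); lra.
apply: (@le_of_small_square R (Num.min t1 t2) _ _ (\sum_i c i * g i ^+ 4)).
- by rewrite lt_min t10.
- by apply: sumr_ge0 => i _; rewrite mulr_ge0 // (exprM _ 2 2) sqr_ge0.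
move=> t /andP[tpos]; rewrite le_min => /andP[tt1 tt2].
have := @rounding_energy_second_difference R V I a c x0 x y t.
rewrite /= -/s -/g => e.
have := feasible t; rewrite gtr0_norm // => /(_ tt1 tt2) h1.
have := feasible (- t); rewrite normrN gtr0_norm // => /(_ tt1 tt2) h2.
set q := _ - \sum_v _ in e.
have : 0 <= 2 * t ^+ 2 * q by rewrite -e; lra.
rewrite pmulr_rge0; last by rewrite mulr_gt0 // exprn_gt0.
by rewrite /q subr_ge0.
Qed.

(** Weights [c i] are chosen so that every tight constraint with [b i != 0]
    contributes exactly 128 to the potential, which is at most [16 * N]; hence
    there are at most [N / 8] of them. The convention [0^-1 = 0] gives weight
    zero to the constraints with [b i = 0], which are preserved exactly and
    counted separately. *)
Lemma partial_rounding (R : realType) (V I : finType) (a : I -> V -> R)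
    (b : I -> R) (x0 : V -> R) (N : R) :
  (forall i v, `|a i v| <= 1) -> (forall v, 0 <= x0 v <= 1) ->
  (forall i, 0 <= b i) -> #|fractional x0|%:R <= 16 * N ->
  N * \sum_i (b i ^+ 4)^-1 <= 1 ->
  exists x : V -> R, [/\ forall v, 0 <= x v <= 1,
    forall i, `|shift_along (a i) x0 x| <= 128 * b i &
    #|fractional x|%:R <= #|[set i | b i == 0]|%:R + N / 2].
Proof.
move=> a1 x01 b0 A0N bN.
have N0 : 0 <= N by have := ler0n R #|fractional x0|; lra.
pose c i := (128 ^+ 3)^-1 * (b i ^+ 4)^-1.
have c0 i : 0 <= c i by rewrite mulr_ge0 // invr_ge0 exprn_ge0.
have Kb0 i : 0 <= 128 * b i by rewrite mulr_ge0.
have [x [x1 sub sb pot dim]] := energy_minimiser a x01 Kb0 c0.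
set s := fun i => shift_along (a i) x0 x; exists x; split=> //.
have potN : \sum_i c i * s i ^+ 4 <= 16 * N by apply: le_trans pot A0N.
pose Z := [set i | b i == 0].
pose T0 := [set i | `|s i| == 128 * b i].
have tight : #|T0|%:R <= #|Z|%:R + N / 8.
  pose T := [set i | (`|s i| == 128 * b i) && (b i != 0)].
  have T128 : 128 * #|T|%:R <= \sum_i c i * s i ^+ 4.
    rewrite -sum1_card natr_sum mulr_sumr big_mkcond /=; apply: ler_sum => i _.
    case: ifP => [|_]; last by rewrite mulr_ge0 // (exprM _ 2 2) sqr_ge0.
    rewrite inE => /andP[/eqP si bi].
    have -> : s i ^+ 4 = (128 * b i) ^+ 4 by rewrite -si -normrX ger0_norm // (exprM _ 2 2) sqr_ge0.
    suff -> : c i * (128 * b i) ^+ 4 = 128 by rewrite mulr1.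
    by rewrite /c; field.
  have : (#|T0| <= #|Z| + #|T|)%N.
    apply: leq_trans (leq_card_setU _ _).
    apply/subset_leq_card/subsetP => i; rewrite !inE => ->.
    by rewrite orbN.
  by rewrite -(ler_nat R) natrD; lra.
(* The square of [s^2 / 8 - 384 N] trades the quadratic terms of the trace
   against the quartic potential. *)
have quad : \sum_i 6 * c i * s i ^+ 2 * \sum_(v in fractional x) a i v ^+ 2
    <= \sum_i (c i * s i ^+ 4 / 64 + (384 * N) ^+ 2 * c i).
  apply: ler_sum => i _.
  have aN : \sum_(v in fractional x) a i v ^+ 2 <= 16 * N.
    apply: le_trans A0N; apply: (@le_trans _ _ #|fractional x|%:R); last first.
      by rewrite ler_nat subset_leq_card.
    rewrite -sum1_card natr_sum; apply: ler_sum => v _.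
    by rewrite -real_normK ?num_real // expr_le1.
  apply: (@le_trans _ _ (6 * c i * s i ^+ 2 * (16 * N))).
    apply: ler_wpM2l aN; apply: mulr_ge0; last exact: sqr_ge0.
    by apply: mulr_ge0.
  rewrite -subr_ge0.
  have -> : c i * s i ^+ 4 / 64 + (384 * N) ^+ 2 * c i
      - 6 * c i * s i ^+ 2 * (16 * N) = c i * (s i ^+ 2 / 8 - 384 * N) ^+ 2 by field.
  by apply: mulr_ge0 => //; exact: sqr_ge0.
have : (384 * N) ^+ 2 * \sum_i c i <= N / 8.
  rewrite -mulr_sumr; set S := \sum_i _ in bN *.
  have -> : (384 * N) ^+ 2 * ((128 ^+ 3)^-1 * S) = 9 / 128 * (N * (N * S)) by field.
  by have := ler_wpM2l N0 bN; lra.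
rewrite big_split -mulr_suml -mulr_sumr /= in quad.
rewrite -/(s _) in dim.
lra.
Qed.

(** * Constraints sorted by length *)

Lemma geometric_sum_le2 (R : realFieldType) (r : R) n :
  0 <= r <= 2^-1 -> \sum_(k < n) r ^+ k <= 2.
Proof.
move=> /andP[r0 r2]; suff : \sum_(k < n) r ^+ k <= 2 - 2 * r ^+ n.
  by have := exprn_ge0 n r0; lra.
elim: n => [|n IHn]; first by rewrite big_ord0 expr0; lra.
rewrite big_ord_recr /= exprS; have := exprn_ge0 n r0; nra.
Qed.

Section Levels.
Context {R : realType} {I : finType} (lev : I -> nat).
Hypothesis lev_count : forall l, (#|[set i | lev i <= l]| <= 2 * 16 ^ l.+1)%N.

Lemma card_level_eq k : (8 * #|[set i | lev i + 2 == k]| <= 16 ^ k)%N.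
Proof.
case: k => [|[|l]].
- by rewrite (_ : [set _ | _] = set0) ?cards0 //; apply/setP => i; rewrite !inE; lia.
- by rewrite (_ : [set _ | _] = set0) ?cards0 //; apply/setP => i; rewrite !inE; lia.
have := lev_count l; rewrite !expnS.
have : (#|[set i | lev i + 2 == l.+2]| <= #|[set i | lev i <= l]|)%N.
  by apply/subset_leq_card/subsetP => i; rewrite !inE; lia.
lia.
Qed.

(** Constraints of level [l] may move in the phases ending with at most [16 ^ L]
    fractional coordinates, for [L <= l + 2]. The offset 2 is what makes the
    constraints that are still frozen a small fraction of [16 ^ L], and none at
    all in the last phases, where there is no room for an exact constraint
    besides the coordinate sum. *)
Lemma card_level_lt L : (128 * #|[set i | lev i + 2 < L]| <= 16 ^ L)%N.
Proof.
case: L => [|[|[|l]]];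
  try by rewrite (_ : [set _ | _] = set0) ?cards0 //; apply/setP => i; rewrite !inE; lia.
have := lev_count l; rewrite !expnS.
have : (#|[set i | lev i + 2 < l.+3]| <= #|[set i | lev i <= l]|)%N.
  by apply/subset_leq_card/subsetP => i; rewrite !inE; lia.
lia.
Qed.

(** Level by level, the count grows like [16 ^ k] and the weight decays like
    [81 ^ - k]. *)
Lemma sum_level_decay L :
  \sum_(i | (L <= lev i + 2)%N) (81 ^+ (lev i + 2 - L))^-1 <= 16 ^+ L :> R.
Proof.
pose J := (\max_i lev i).+3.
pose A k := [set i | (lev i + 2 == k + L)%N].
have -> : \sum_(i | (L <= lev i + 2)%N) (81 ^+ (lev i + 2 - L))^-1
    = \sum_(k < J) #|A k|%:R * (81 ^+ k)^-1 :> R.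
  have e (k : 'I_J) : #|A k|%:R * (81 ^+ k)^-1
      = \sum_(i | (L <= lev i + 2)%N) (if (lev i + 2 - L == k)%N then (81 ^+ k)^-1 else 0) :> R.
    rewrite -sum1_card natr_sum mulr_suml -big_mkcondr.
    by apply: eq_big => [i|i _]; rewrite ?mul1r // inE; lia.
  under [RHS]eq_bigr do rewrite e.
  rewrite exchange_big; apply: eq_bigr => i Li.
  have iJ : (lev i + 2 - L < J)%N by have := @leq_bigmax I lev i; rewrite /J; lia.
  rewrite (bigD1 (Ordinal iJ)) //= eqxx big1 ?addr0 // => k.
  by rewrite -val_eqE /= eq_sym => /negbTE ->.
apply: (@le_trans _ _ (\sum_(k < J) 16 ^+ L / 8 * (16 / 81) ^+ k)).
  apply: ler_sum => k _; have := card_level_eq (k + L)%N.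
  rewrite -(ler_nat R) natrM !natrX exprD expr_div_n => h.
  have e : 0 < (81 ^+ k)^-1 :> R by rewrite invr_gt0 exprn_gt0.
  rewrite mulrA ler_pM2r // mulrC mulrA; lra.
rewrite -mulr_sumr.
have := @geometric_sum_le2 R (16 / 81) J; have := @exprn_ge0 R L 16.
set S := \sum_(_ < _) _; nra.
Qed.

End Levels.

(** * Rounding in phases *)

Section Rounding.
Context {R : realType} {V : finType}.
Implicit Type x : V -> R.

Lemma integral_off_fractional x v :
  (forall v, 0 <= x v <= 1) -> v \notin fractional x -> x v = (x v == 1)%:R.
Proof.
move=> /(_ v) /andP[x0 x1]; rewrite inE negb_and -!leNgt.
case: eqVneq => [->//|xN1] /orP[h|h].
  by apply/le_anti; rewrite h x0.
by case/eqP: xN1; apply/le_anti; rewrite x1 h.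
Qed.

(** A single fractional coordinate would make the integral sum fractional. *)
Lemma fractional_eq0 x (q : nat) :
  (forall v, 0 <= x v <= 1) -> \sum_v x v = q%:R ->
  (#|fractional x| <= 1)%N -> fractional x = set0.
Proof.
move=> x01 xq; rewrite leq_eqVlt ltnS leqn0 cards_eq0 => /orP[/cards1P[v fv]|/eqP//].
have := xq; rewrite (bigD1 v) //=.
rewrite (eq_bigr (fun u => (x u == 1)%:R)) => [|u uv]; last first.
  by apply: integral_off_fractional; rewrite // fv inE.
rewrite -natr_sum; set p := (\sum_(_ | _) _)%N => e.
have : v \in fractional x by rewrite fv set11.
rewrite inE => /andP[v0 v1].
have : (p < q)%N by rewrite -(ltr_nat R); lra.
have : (q < p.+1)%N by rewrite -(ltr_nat R) -natr1; lra.
lia.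
Qed.

Lemma shift_along_trans (f x0 x1 x2 : V -> R) :
  shift_along f x0 x2 = shift_along f x0 x1 + shift_along f x1 x2.
Proof.
rewrite /shift_along -big_split; apply: eq_bigr => v _ /=; ring.
Qed.

(** A constraint of level [m - 2] is allowed to move by 128 times this amount in
    the phase that ends with at most [16 ^ L] fractional coordinates; the value 0
    stands for constraints too short to be touched by that phase. *)
Definition phase_error (m L : nat) : nat :=
  if (L <= m)%N then (4 ^ L * 3 ^ (m - L))%N else 0%N.

(** An upper bound for the sum of [phase_error m l] over [l < L], in the closed
    form in which consecutive phases telescope. *)
Definition level_error (m L : nat) : nat := (3 ^ (m.+1 - L) * 4 ^ minn L m.+1)%N.

Lemma level_error_step m L :
  (level_error m L + phase_error m L <= level_error m L.+1)%N.
Proof.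
rewrite /level_error /phase_error; case: (leqP L m) => h.
  have -> : minn L m.+1 = L by lia.
  have -> : minn L.+1 m.+1 = L.+1 by lia.
  by rewrite subSS subSn // !expnS; lia.
have -> : minn L m.+1 = m.+1 by lia.
have -> : minn L.+1 m.+1 = m.+1 by lia.
have -> : (m.+1 - L)%N = 0%N by lia.
have -> : (m.+1 - L.+1)%N = 0%N by lia.
by rewrite addn0.
Qed.

Lemma level_error_le m L : (level_error m L <= 4 ^ m.+1)%N.
Proof.
rewrite /level_error -[X in (_ <= _ ^ X)%N](subnK (geq_minr L m.+1)) expnD.
rewrite leq_mul2r; apply/orP; right.
have -> : (m.+1 - minn L m.+1 = m.+1 - L)%N by lia.
by case: (m.+1 - L)%N => // k; rewrite leq_exp2r.
Qed.

Variables (I : finType) (lev : I -> nat) (a : I -> V -> R).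
Hypothesis lev_count : forall l, (#|[set i | lev i <= l]| <= 2 * 16 ^ l.+1)%N.
Hypothesis a1 : forall i v, `|a i v| <= 1.

(** The extra constraint [inr tt], with constant coefficients 1 and bound 0,
    preserves the coordinate sum. *)
Lemma rounding_phase L x0 :
  (forall v, 0 <= x0 v <= 1) -> (#|fractional x0| <= 16 ^ L.+1)%N ->
  exists x, [/\ forall v, 0 <= x v <= 1, \sum_v x v = \sum_v x0 v,
    (#|fractional x| <= 16 ^ L)%N &
    forall i, `|shift_along (a i) x0 x| <=
      128 * (phase_error (lev i + 2) L)%:R].
Proof.
move=> x01 fx0.
pose a' (o : I + unit) := if o is inl i then a i else fun=> 1.
pose b' (o : I + unit) : R := if o is inl i then
  (phase_error (lev i + 2) L)%:R else 0.
have b0 o : 0 <= b' o by case: o => [i|u]; rewrite ?ler0n.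
have a'1 o v : `|a' o v| <= 1 by case: o => [i|u]; rewrite ?a1 //= normr1.
have fx0R : #|fractional x0|%:R <= 16 * 16 ^+ L :> R.
  by rewrite -exprS -natrX ler_nat.
(* The fourth power of [4 ^ L * 3 ^ j] is [(16 ^ L) ^ 2 * 81 ^ j]. *)
have bN : 16 ^+ L * \sum_o (b' o ^+ 4)^-1 <= 1 :> R.
  have -> : \sum_o (b' o ^+ 4)^-1 = (16 ^+ L)^-2 *
      \sum_(i | (L <= lev i + 2)%N) (81 ^+ (lev i + 2 - L))^-1 :> R.
    rewrite big_sumType /= [X in _ + X]big1 => [|u _]; last by rewrite expr0n invr0.
    rewrite addr0 mulr_sumr [RHS]big_mkcond /=.
    apply: eq_bigr => i _; rewrite /phase_error; case: ifP => _; last by rewrite expr0n invr0.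
    rewrite natrM !natrX -invfM; congr (_^-1).
    have -> : 16 = 4 ^+ 2 :> R by ring.
    have -> : 81 = 3 ^+ 4 :> R by ring.
    by rewrite exprMn -!exprM; congr (_ ^+ _ * _ ^+ _); lia.
  have p0 : 0 < 16 ^+ L :> R by rewrite exprn_gt0.
  have := @sum_level_decay R I lev lev_count L; set S := \sum_(_ | _) _ => SL.
  have -> : 16 ^+ L * (16 ^+ L ^- 2 * S) = S / 16 ^+ L by field; rewrite gt_eqF.
  by rewrite ler_pdivrMr // mul1r.
have [x [x1 sx fx]] := partial_rounding a'1 x01 b0 fx0R bN.
exists x; split=> //.
- have := sx (inr tt); rewrite /= mulr0 normr_le0 /shift_along.
  by rewrite (eq_bigr _ (fun v _ => mul1r _)) sumrB subr_eq0 => /eqP.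
- have zeros : (#|[set o | b' o == 0%R]| <= #|[set i | lev i + 2 < L]| + 1)%N.
    rewrite -[X in (_ <= _ + X)%N](cards1 (inr tt : I + unit)) -(card_imset _ (@inl_inj I unit)).
    apply: leq_trans (leq_card_setU _ _); apply/subset_leq_card/subsetP => -[i|[]].
      rewrite !inE /= pnatr_eq0 orbF => h; apply: imset_f; rewrite inE.
      rewrite ltnNge; apply: contraL h => Li.
      by rewrite /phase_error Li muln_eq0 !expn_eq0.
    by rewrite !inE eqxx orbT.
  have small := card_level_lt lev_count L.
  have : (2 * #|fractional x| <= 2 * #|[set o | b' o == 0%R]| + 16 ^ L)%N.
    by rewrite -(ler_nat R) natrM natrD natrM natrX; lra.
  case: (L) small zeros => [|l]; rewrite ?expnS; first lia.
  have : (0 < 16 ^ l)%N by rewrite expn_gt0.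
  lia.
- by move=> i; have := sx (inl i).
Qed.

Lemma rounding_phases L x0 (q : nat) :
  (forall v, 0 <= x0 v <= 1) -> \sum_v x0 v = q%:R ->
  (#|fractional x0| <= 16 ^ L)%N ->
  exists x, [/\ forall v, 0 <= x v <= 1, \sum_v x v = q%:R, fractional x = set0 &
    forall i, `|shift_along (a i) x0 x| <= 128 * (level_error (lev i + 2) L)%:R].
Proof.
elim: L x0 => [|L IHL] x0 x01 x0q fx0.
  exists x0; split=> //; first exact: fractional_eq0 x01 x0q fx0.
  by move=> i; rewrite /shift_along big1 ?normr0 ?mulr_ge0 // => v _; rewrite subrr mulr0.
have [x1 [x1box x1sum fx1 sx1]] := rounding_phase x01 fx0.
have [x [xbox xsum fx sx]] := IHL x1 x1box (etrans x1sum x0q) fx1.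
exists x; split=> // i; rewrite (shift_along_trans _ _ x1).
apply: le_trans (ler_normD _ _) _; apply: le_trans (lerD (sx1 i) (sx i)) _.
by rewrite -mulrDr -natrD ler_pM2l // ler_nat addnC level_error_step.
Qed.

(** Constraints of level [l] should be thought of as having length about
    [16 ^ l], so the error is of the order of the square root of the length. *)
Theorem levelled_rounding x0 (q : nat) :
  (forall v, 0 <= x0 v <= 1) -> \sum_v x0 v = q%:R ->
  exists X : {set V}, #|X| = q /\ forall i,
    `|\sum_(v in X) a i v - \sum_v a i v * x0 v| <= 8192 * 4 ^+ lev i.
Proof.
move=> x01 x0q.
have fx0 : (#|fractional x0| <= 16 ^ #|V|)%N.
  by apply: leq_trans (max_card _) (ltnW (ltn_expl _ _)).
have [x [xbox xsum fx sx]] := rounding_phases x01 x0q fx0.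
pose X := [set v | x v == 1].
have xE v : x v = (v \in X)%:R.
  by rewrite inE; apply: integral_off_fractional; rewrite // fx inE.
exists X; split.
  apply/eqP; rewrite -(eqr_nat R) -xsum -sum1_card natr_sum big_mkcond /=.
  by apply/eqP/eq_bigr => v _; rewrite xE; case: (v \in X).
move=> i; have -> : \sum_(v in X) a i v - \sum_v a i v * x0 v = shift_along (a i) x0 x.
  rewrite /shift_along [X in X - _]big_mkcond -sumrB; apply: eq_bigr => v _.
  by rewrite xE mulrBr; case: (v \in X); rewrite ?mulr1 ?mulr0.
apply: le_trans (sx i) _.
have := level_error_le (lev i + 2) #|V|.
rewrite -(ler_nat R) natrX addn2 !exprS; lra.
Qed.
End Rounding.

(** * Tournaments *)

(** Each pair of vertices of [D] carries one arc, counted in the out-degree of one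
    of the two. *)
Lemma card_small_out_degree (V : finType) (arc : rel V) k :
  tournament arc -> (#|[set v | out_degree arc v < k]| <= 2 * k)%N.
Proof.
move=> [irr tot]; case: k => [|k].
  by rewrite (_ : [set _ | _] = set0) ?cards0 //; apply/setP => v; rewrite !inE.
set D := [set v | _]; set n := #|D|.
pose S := (\sum_(v in D) \sum_(w in D) arc v w)%N.
have S_le : (S <= n * k)%N.
  rewrite -sum_nat_const; apply: leq_sum => v; rewrite inE => dv.
  apply: (@leq_trans (out_degree arc v)); last by rewrite -ltnS.
  rewrite /out_degree -sum1_card big_mkcond [leqRHS]big_mkcond /=.
  by apply: leq_sum => w _; case: (w \in D); rewrite inE; case: (arc v w).
have S2 : (S + S = n * n.-1)%N.
  rewrite {2}/S exchange_big /= -big_split -sum_nat_const /=.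
  apply: eq_bigr => v vD; rewrite -big_split /= (bigD1 v) //= irr !add0n.
  rewrite /n (cardsD1 v) vD add1n /= -sum1_card; apply: eq_big => [w|w /andP[_ wv]].
    by rewrite !inE andbC.
  by have := tot w v wv; case: (arc v w); case: (arc w v).
have : (n * n.-1 <= n * (2 * k))%N by lia.
by case: (n) => // m; rewrite leq_mul2l /=; lia.
Qed.

Theorem lemma3p9 (R : realType) :
  exists B : R, 0 < B /\
    forall (M : nat) (V : finType) (arc : rel V) (q : nat),
      (0 < M)%N -> #|V| = M -> tournament arc -> (q <= M)%N ->
      exists X : {set V}, #|X| = q /\
        forall v : V,
          `| #|out_nbhd arc v :&: X|%:R
             - q%:R / M%:R * (out_degree arc v)%:R |
          <= B * Num.sqrt (out_degree arc v)%:R.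
Proof.
exists 8192; split; first lra.
move=> M V arc q M0 VM tour qM.
pose a (v w : V) : R := (arc v w)%:R.
pose lev v := trunc_log 16 (out_degree arc v).
have lev_count l : (#|[set v | lev v <= l]| <= 2 * 16 ^ l.+1)%N.
  apply: leq_trans (card_small_out_degree _ tour).
  apply/subset_leq_card/subsetP => v; rewrite !inE => lv.
  by apply: leq_trans (@trunc_log_ltn 16 _ isT) _; rewrite leq_exp2l // ltnS.
have a1 v w : `|a v w| <= 1 by rewrite /a; case: (arc v w); rewrite ?normr1 ?normr0.
have MR : 0 < M%:R :> R by rewrite ltr0n.
have box (v : V) : 0 <= (q%:R / M%:R : R) <= 1.
  by rewrite divr_ge0 //= ler_pdivrMr // mul1r ler_nat.
have tot : \sum_(v : V) q%:R / M%:R = q%:R :> R.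
  by rewrite sumr_const VM -[_ *+ _]mulr_natr divfK // gt_eqF.
have [X [Xq HX]] := levelled_rounding lev_count a1 box tot.
exists X; split=> // v; have := HX v.
have -> : \sum_(w in X) a v w = #|out_nbhd arc v :&: X|%:R.
  rewrite -sum1_card natr_sum big_mkcond [RHS]big_mkcond; apply: eq_bigr => w _.
  by rewrite !inE /a; case: (w \in X); case: (arc v w).
have -> : \sum_w a v w * (q%:R / M%:R) = q%:R / M%:R * (out_degree arc v)%:R.
  rewrite -mulr_suml mulrC /out_degree -sum1_card natr_sum [in RHS]big_mkcond.
  by congr (_ * _); apply: eq_bigr => w _; rewrite inE /a; case: (arc v w).
(* Level 0 also contains the vertices without out-neighbours, for which the
   claimed bound is 0. *)
have [d0 _|d0 h] := posnP (out_degree arc v).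
  have /eqP nb0 : out_nbhd arc v == set0 by rewrite -cards_eq0 -/(out_degree arc v) d0.
  by rewrite nb0 set0I cards0 d0 sqrtr0 !mulr0 subrr normr0.
apply: le_trans h _; rewrite ler_pM2l //.
have -> : 4 ^+ lev v = Num.sqrt (16 ^+ lev v) :> R.
  have -> : 16 = 4 ^+ 2 :> R by ring.
  by rewrite -exprM mulnC exprM sqrtr_sqr ger0_norm // exprn_ge0.
by rewrite ler_wsqrtr // -natrX ler_nat trunc_logP.
Qed.
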